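(* Let $q=2^m$ where $m\ge 4$ is even. Let $\mathcal{P}=\mathrm{GF}(q)$, $B=\{u\in\mathrm{GF}(q):\mathrm{Tr}(u^3)=1\}$ and $\mathcal{B}=\{g(B):g\in\mathrm{GA}_1(q)\}$, where $\mathrm{GA}_1(q)=\{x\mapsto ax+b:a\in\mathrm{GF}(q)^*,b\in\mathrm{GF}(q)\}$. Then $(\mathcal{P},\mathcal{B})$ is a $2$-$(2^m,k,k(k-1)/12)$ design, where $k=2^{m-1}+(-2)^{m/2}$.
   Context: $\mathrm{Tr}$ denotes the absolute trace from $\mathrm{GF}(2^m)$ to $\mathrm{GF}(2)$. A $t$-$(v,k,\lambda)$ design is a pair $(\mathcal{P},\mathcal{B})$ with $|\mathcal{P}|=v$ and $\mathcal{B}$ a set of $k$-subsets of $\mathcal{P}$ such that every $t$-subset of $\mathcal{P}$ lies in exactly $\lambda$ members of $\mathcal{B}$. *)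

(* Defs.v *)
From mathcomp Require Import all_boot all_order all_algebra.

Set Implicit Arguments.
Unset Strict Implicit.
Unset Printing Implicit Defensive.

Import GRing.Theory.
Local Open Scope ring_scope.

(* The absolute trace from GF(2^m), when #|F| = 2 ^ m. Its values lie in the
   prime subfield {0, 1} of F, which stands for GF(2). *)
Definition abs_trace (F : finFieldType) (m : nat) (x : F) : F :=
  \sum_(i < m) x ^+ (2 ^ i).

Definition GA1 (F : finFieldType) : {set {ffun F -> F}} :=
  [set [ffun x => a * x + b] | a in [set a : F | a != 0], b in [set: F]].

(* The blocks form a set, so equal images of the base block count once. *)
Definition is_design (T : finType) (P : {set T}) (Bs : {set {set T}})
    (t v k lambda : nat) : Prop :=
  [/\ #|P| = v,
      forall X : {set T}, X \in Bs -> X \subset P /\ #|X| = k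
    & forall X : {set T}, X \subset P -> #|X| = t ->
        #|[set Y in Bs | X \subset Y]| = lambda].

Definition base_block (F : finFieldType) (m : nat) : {set F} :=
  [set u : F | abs_trace m (u ^+ 3) == 1].

Definition GA1_blocks (F : finFieldType) (B : {set F}) : {set {set F}} :=
  [set [set g x | x in B] | g : {ffun F -> F} in GA1 F].

(* Main.v *)
(* With [chi = (-1)^Tr], the sum [S] of [chi (u^3)] over [GF(q)] satisfies
   [S^2 = 4 q], because [Tr (u^2 w + u w^2) = Tr (u^2 (w + w^4))] vanishes for
   all [u] exactly when [w] is in [GF(4)].  The sign of [S] follows from
   [3 | #|B|], as the cube roots of unity act freely on [B] by multiplication.
   The map [x |-> a x + b] stabilizes [B] iff [a^3 = 1] and [b^4 = b], so each
   block is the image of [B] under exactly 12 affine maps; as the affine group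
   is sharply 2-transitive, 12 times the number of blocks through two points is
   the number [k (k - 1)] of ordered pairs of distinct points of [B]. *)
Require Import Defs.
From mathcomp Require Import all_boot all_order all_algebra.
From mathcomp Require Import fingroup pgroup finfield.
From mathcomp Require Import ring zify.

Set Implicit Arguments.
Unset Strict Implicit.
Unset Printing Implicit Defensive.

Import GRing.Theory.
Local Open Scope ring_scope.

(** Serves twice: for cubing on the base block, and for the passage from affine maps to blocks. *)
Lemma card_fibers (I J : finType) (f : I -> J) (D : {set I}) (n : nat) :
    (forall x, x \in D -> #|[set y in D | f y == f x]| = n) ->
  #|D| = (#|f @: D| * n)%N.
Proof.
move=> fib; rewrite -sum1_card (partition_big_imset f) /= -sum_nat_const.
apply: eq_bigr => _ /imsetP[x Dx ->].
by rewrite -(fib x Dx) sum1dep_card.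
Qed.

(** * The absolute trace and its additive character *)

Section Trace.
Variables (m : nat) (F : finFieldType).
Hypotheses (m_gt0 : (0 < m)%N) (cardF : #|F| = (2 ^ m)%N).

Local Notation tr := (abs_trace m).

Lemma pcharF2 : 2%N \in [pchar F].
Proof. exact: card_finPcharP cardF _. Qed.

Lemma two_eq0 : (2 : F) = 0.
Proof. exact: pcharf0 pcharF2. Qed.

Lemma abs_traceD (x y : F) : tr (x + y) = tr x + tr y.
Proof.
rewrite /abs_trace -big_split /=; apply: eq_bigr => i _.
by rewrite exprDn_pchar // pnatX pnatE // pcharF2.
Qed.

Lemma abs_trace0 : tr 0 = 0 :> F.
Proof. by apply: big1 => i _; rewrite expr0n expn_eq0. Qed.

(** Squaring permutes the summands cyclically, since [x ^+ (2 ^ m) = x]. *)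
Lemma abs_trace_sqr (x : F) : tr (x ^+ 2) = tr x.
Proof.
have Fx := expf_card x; rewrite cardF in Fx.
rewrite /abs_trace -(prednK m_gt0) in Fx *.
rewrite big_ord_recr big_ord_recl /= expn0 expr1 addrC -exprM -expnS Fx.
by congr (_ + _); apply: eq_bigr => i _; rewrite -exprM -expnS.
Qed.

Lemma sqr_abs_trace (x : F) : tr x ^+ 2 = tr x.
Proof.
rewrite -{2}abs_trace_sqr /abs_trace -(pFrobenius_autE pcharF2) rmorph_sum /=.
by apply: eq_bigr => i _; rewrite pFrobenius_autE -!exprM mulnC.
Qed.

Lemma abs_trace01 (x : F) : tr x = 0 \/ tr x = 1.
Proof.
have/eqP := sqr_abs_trace x; rewrite -subr_eq0 expr2 -{3}[tr x]mulr1 -mulrBr.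
by rewrite mulf_eq0 subr_eq0 => /orP[]/eqP; [left|right].
Qed.

(** The trace is a polynomial of degree [2 ^ m.-1], too small to have all [2 ^ m] elements as
    roots. *)
Lemma abs_trace_neq0 : exists x : F, tr x != 0.
Proof.
case: (pickP (fun x : F => tr x != 0)) => [x trx|tr0]; first by exists x.
pose p : {poly F} := \sum_(i < m) 'X^(2 ^ i).
have szp : size p = (2 ^ m.-1).+1.
  rewrite /p -(prednK m_gt0) big_ord_recr /= addrC size_polyDl ?size_polyXn //.
  rewrite ltnS; apply: leq_trans (size_sum _ _ _) _; apply/bigmax_leqP => i _.
  by rewrite size_polyXn ltn_exp2l.
have p0 : p != 0 by rewrite -size_poly_eq0 szp.
have rt : all (root p) (enum F).
  apply/allP => x _; rewrite /root /p horner_sum.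
  by under eq_bigr do rewrite hornerXn; have /negbFE := tr0 x.
have := max_poly_roots p0 rt (enum_uniq F); rewrite szp -cardE cardF.
by rewrite ltnS leq_exp2l // -ltnS prednK // ltnn.
Qed.

Lemma sqrt_pchar2 (x : F) : exists y, y ^+ 2 = x.
Proof.
by exists (x ^+ (2 ^ m.-1)); rewrite -exprM -expnSr prednK // -cardF expf_card.
Qed.

(** Squaring is onto, so for nonzero [c] the products [u ^+ 2 * c] run through the whole field. *)
Lemma abs_trace_nondeg (c : F) : (forall u, tr (u ^+ 2 * c) = 0) -> c = 0.
Proof.
move=> trc; apply/eqP/negPn/negP => c0.
have [x /negP[]] := abs_trace_neq0; apply/eqP.
have [y yE] := sqrt_pchar2 (x / c).
by rewrite -(trc y) yE divfK.
Qed.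

(** The character [(-1)^Tr], with integer values so that its sums are taken in characteristic
    zero. *)
Definition trace_char (x : F) : int := if tr x == 0 then 1 else - 1.

Lemma trace_charD (x y : F) :
  trace_char (x + y) = trace_char x * trace_char y.
Proof.
have o0 := oner_eq0 F.
rewrite /trace_char abs_traceD.
case: (abs_trace01 x) => ->; case: (abs_trace01 y) => ->;
  by rewrite ?addr0 ?add0r ?(addrr_pchar2 pcharF2) ?eqxx ?o0.
Qed.

Lemma trace_char0 : trace_char 0 = 1.
Proof. by rewrite /trace_char abs_trace0 eqxx. Qed.

Lemma sum_trace_char (c : F) :
  \sum_u trace_char (u ^+ 2 * c) = if c == 0 then #|F|%:Z else 0.
Proof.
case: eqP => [->|/eqP c0].
  under eq_bigr do rewrite mulr0 trace_char0.
  by rewrite sumr_const -natz.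
have [v trv] : exists v, tr (v ^+ 2 * c) != 0.
  case: (pickP (fun v : F => tr (v ^+ 2 * c) != 0)) => [v trv|tr0]; first by exists v.
  by case/eqP: c0; apply: abs_trace_nondeg => u; apply/eqP/negbFE/tr0.
(* Translating [u] by [v] multiplies every term by the value -1 of the character at [v ^+ 2 * c]. *)
set S := \sum_u _; suff : S = - S by lia.
rewrite {1}/S (reindex_inj (addrI v)) /= -mulN1r /S mulr_sumr.
apply: eq_bigr => u _.
have -> : (v + u) ^+ 2 * c = v ^+ 2 * c + u ^+ 2 * c.
  by have t := two_eq0; ring: t.
by rewrite trace_charD; congr (_ * _); rewrite /trace_char (negPf trv).
Qed.

End Trace.

(** * Cube roots of unity *)

Lemma exists_cube_root1 (F : finFieldType) :
  (3 %| #|F|.-1)%N -> exists2 w : F, w != 1 & w ^+ 3 = 1.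
Proof.
rewrite -card_finField_unit => dvd3.
have [x _ ox] := @Cauchy _ 3 [set: {unit F}]%G isT dvd3.
exists (val x).
  apply: contra_eq_neq ox => x1; suff -> : x = 1%g by rewrite order1.
  exact: val_inj.
by rewrite -FinRing.val_unitX -ox expg_order.
Qed.

Lemma card_cube_roots1 (F : finFieldType) :
  (3 %| #|F|.-1)%N -> #|[set x : F | x ^+ 3 == 1]| = 3%N.
Proof.
move=> /exists_cube_root1[w w1 w3].
have w0 : w != 0 by apply: contra_eq_neq w3 => ->; rewrite expr0n eq_sym oner_eq0.
have ww : w ^+ 2 + w + 1 = 0.
  have/eqP : (w - 1) * (w ^+ 2 + w + 1) = 0 by rewrite -(subrr 1) -{3}w3; ring.
  by rewrite mulf_eq0 subr_eq0 (negPf w1) => /eqP.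
have -> : [set x : F | x ^+ 3 == 1] = [set 1; w; w ^+ 2].
  apply/setP => x; rewrite !inE -!(subr_eq0 x) -!mulf_eq0 -subr_eq0.
  congr (_ == 0).
  have -> : w ^+ 2 = - w - 1 by rewrite -(add0r (- w - 1)) -ww; ring.
  (* The factorization of [x ^+ 3 - 1] into linear factors holds modulo [w ^+ 2 + w + 1], which is
     zero. *)
  transitivity ((x - 1) * (x ^+ 2 + x + 1)); first by ring.
  transitivity ((x - 1) * (x ^+ 2 + x + 1 - (w ^+ 2 + w + 1))); last by ring.
  by rewrite ww subr0.
have w21 : w ^+ 2 != 1.
  by apply: contra_neq w1 => w2; rewrite -w3 exprS w2 mulr1.
have w2w : w ^+ 2 != w by rewrite expr2 -{3}[w]mulr1 (inj_eq (mulfI w0)).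
by rewrite setUC !cardsU1 cards1 !inE (negPf w21) (negPf w2w) eq_sym (negPf w1).
Qed.

(** * The cubic character sum and the size of the base block *)

Section Cube.
Variables (m : nat) (F : finFieldType).
Hypotheses (m_ge4 : (4 <= m)%N) (m_even : ~~ odd m) (cardF : #|F| = (2 ^ m)%N).

Let m_gt0 : (0 < m)%N.
Proof. by apply: leq_trans m_ge4. Qed.

Local Notation tr := (abs_trace m).
Local Notation chi := (@trace_char m F).
Local Notation B := (base_block F m).

(** For even [m] the field order is a power of 4, hence 1 modulo 3. *)
Let dvd3F : (3 %| #|F|.-1)%N.
Proof.
rewrite cardF -(odd_double_half m) (negPf m_even) -muln2 mulnC expnM.
exact: (dvdn_pred_predX 4).
Qed.

Lemma fixed_expr4P (x : F) : (x ^+ 4 == x) = (x == 0) || (x ^+ 3 == 1).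
Proof.
by rewrite -subr_eq0 exprS -[X in _ - X]mulr1 -mulrBr mulf_eq0 subr_eq0.
Qed.

(** These elements form the subfield GF(4): zero and the three cube roots of unity. *)
Lemma card_fixed_expr4 : #|[set x : F | x ^+ 4 == x]| = 4%N.
Proof.
have -> : [set x : F | x ^+ 4 == x] = 0 |: [set x : F | x ^+ 3 == 1].
  by apply/setP => x; rewrite !inE fixed_expr4P.
by rewrite cardsU1 card_cube_roots1 // inE expr0n eq_sym oner_eq0.
Qed.

Lemma abs_trace1 : tr 1 = 0 :> F.
Proof.
rewrite /abs_trace; under eq_bigr do rewrite expr1n.
by rewrite sumr_const card_ord; apply/eqP; rewrite -(dvdn_pcharf (pcharF2 cardF)) dvdn2.
Qed.

Lemma fixed_expr4_trace (w : F) : w ^+ 4 = w -> tr (w ^+ 3) = 0.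
Proof.
move/eqP; rewrite fixed_expr4P => /orP[]/eqP ->; last exact: abs_trace1.
by rewrite expr0n abs_trace0.
Qed.

(** Invariance of the trace under squaring turns [u * w ^+ 2] into [u ^+ 2 * w ^+ 4], so both mixed
    terms become linear in [u ^+ 2]. *)
Lemma abs_trace_cubeD (u w : F) :
  tr ((u + w) ^+ 3) = tr (u ^+ 3) + tr (u ^+ 2 * (w + w ^+ 4)) + tr (w ^+ 3).
Proof.
have t := two_eq0 cardF.
have -> : (u + w) ^+ 3 = u ^+ 3 + u ^+ 2 * w + u * w ^+ 2 + w ^+ 3.
  (* A zero written as twice the mixed terms raises their coefficients from 1 to 3. *)
  by rewrite -[RHS]addr0 -(mul0r (u ^+ 2 * w + u * w ^+ 2)) -t; ring.
have trD := abs_traceD cardF.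
rewrite mulrDr !trD -(abs_trace_sqr m_gt0 cardF (u * _)) exprMn -exprM.
by rewrite -!addrA.
Qed.

Lemma addr_expr4_eq0 (w : F) : (w + w ^+ 4 == 0) = (w ^+ 4 == w).
Proof. by rewrite addr_eq0 (oppr_pchar2 (pcharF2 cardF)) eq_sym. Qed.

(* Substituting [v = u + w] in the double sum leaves [Tr (u ^ 2 * (w + w ^ 4))]
   as the only term depending on [u], so only [w ^ 4 = w] contributes. *)
Lemma sqr_cubic_sum : (\sum_u chi (u ^+ 3)) ^+ 2 = 4 * #|F|%:Z.
Proof.
have chiD := trace_charD m_gt0 cardF.
have chi2 x : chi x * chi x = 1.
  by rewrite -chiD (addrr_pchar2 (pcharF2 cardF)) trace_char0.
have chi_cubeD u w :
    chi (u ^+ 3) * chi ((u + w) ^+ 3)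
    = chi (u ^+ 2 * (w + w ^+ 4)) * chi (w ^+ 3).
  rewrite -[RHS]mul1r -(chi2 (u ^+ 3)) -mulrA; congr (_ * _).
  by rewrite -!chiD /trace_char abs_trace_cubeD !(abs_traceD cardF) addrA.
transitivity (\sum_w (\sum_u chi (u ^+ 2 * (w + w ^+ 4))) * chi (w ^+ 3)).
  under [RHS]eq_bigr do rewrite mulr_suml.
  rewrite exchange_big expr2 mulr_suml /=; apply: eq_bigr => u _.
  rewrite mulr_sumr (reindex_inj (addrI u)) /=; apply: eq_bigr => w _.
  exact: chi_cubeD.
under eq_bigr do rewrite sum_trace_char //.
rewrite (bigID (mem [set w : F | w ^+ 4 == w])) /= [X in _ + X]big1 ?addr0.
  rewrite (eq_bigr (fun=> #|F|%:Z)).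
    by rewrite sumr_const card_fixed_expr4 mulr_natl.
  move=> w; rewrite inE => w4; rewrite addr_expr4_eq0 w4.
  by rewrite /trace_char (fixed_expr4_trace (eqP w4)) eqxx mulr1.
by move=> w; rewrite inE => /negPf w4; rewrite addr_expr4_eq0 w4 mul0r.
Qed.

Lemma cubic_sumE : \sum_u chi (u ^+ 3) = #|F|%:Z - 2 * #|B|%:Z.
Proof.
have -> : #|B|%:Z = \sum_(u in B) 1 by rewrite sumr_const -natz.
rewrite mulr_sumr -[#|F|%:Z]natz -sumr_const (bigID (mem B)) /=.
rewrite [X in _ = X - _](bigID (mem B)) /=.
rewrite (eq_bigr (fun=> -1 : int)) => [|u]; last first.
  by rewrite inE /trace_char => /eqP ->; rewrite oner_eq0.
rewrite [X in _ + X](eq_bigr (fun=> 1 : int)) => [|u]; last first.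
  rewrite inE /trace_char.
  by case: (abs_trace01 m_gt0 cardF (u ^+ 3)) => ->; rewrite eqxx.
rewrite !sumr_const; lia.
Qed.

Lemma dvd3_base_block : (3 %| #|B|)%N.
Proof.
rewrite (@card_fibers F F (fun u => u ^+ 3) B 3) ?dvdn_mull // => u Bu.
have u0 : u != 0.
  apply: contraTneq Bu => ->.
  by rewrite inE expr0n abs_trace0 eq_sym oner_eq0.
(* The fibre of cubing through [u] is the coset of [u] modulo the cube roots of unity. *)
transitivity #|[set u * w | w in [set w : F | w ^+ 3 == 1]]|; last first.
  by rewrite card_imset ?card_cube_roots1 //; apply: mulfI.
apply: eq_card => x; apply/idP/imsetP => [|[w w3 ->]].
  rewrite inE => /andP[_ /eqP xu].
  exists (x / u); last by rewrite mulrC divfK.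
  by rewrite inE expr_div_n xu divff ?expf_neq0.
by move: w3 Bu; rewrite !inE => /eqP w3; rewrite exprMn w3 mulr1 eqxx andbT.
Qed.

(* [sqr_cubic_sum] gives [#|B|] up to a sign, which [dvd3_base_block] determines. *)
Lemma card_base_block : #|B|%:Z = 2 ^+ (m - 1) + (- 2) ^+ (m %/ 2).
Proof.
have := sqr_cubic_sum; rewrite cubic_sumE cardF.
have /dvdnP[k ->] := dvd3_base_block.
have mE : m = (m./2).*2 by rewrite -{1}(odd_double_half m) (negPf m_even).
have h_gt0 : (0 < m./2)%N by lia.
have -> : (m %/ 2 = m./2)%N by rewrite divn2.
have -> : (m - 1 = m./2 + m./2.-1)%N by lia.
have -> : (2 ^ m)%:Z = 4 * (2 ^+ m./2.-1) ^+ 2.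
  by rewrite {1}mE -(prednK h_gt0) doubleS -addnn -natz natrX !exprS exprD; ring.
move=> E.
(* As 2 is -1 modulo 3, this fixes [2 ^+ m./2.-1] modulo 3, which will decide the sign. *)
have [i pE] : exists i : int, 2 ^+ m./2.-1 = 3 * i + (- 1) ^+ m./2.-1.
  elim: (m./2.-1) => [|n [i IHn]]; first by exists 0; rewrite !expr0.
  by exists (2 * i + (- 1) ^+ n); rewrite !exprS IHn; ring.
rewrite exprD -(prednK h_gt0) [(- 2) ^+ _]exprS [(- 2) ^+ _]exprNn /= exprS.
move: pE E; rewrite -signr_odd; set p := 2 ^+ _ => pE E.
have/eqP : (4 * p ^+ 2 - 6 * k%:Z) ^+ 2 = (4 * p) ^+ 2.
  transitivity ((4 * p ^+ 2 - 2 * (k * 3)%:Z) ^+ 2); last by rewrite E; ring.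
  by rewrite PoszM; ring.
(* The size [3 * k] is [2 * p * (p - 1)] or [2 * p * (p + 1)]; only one of these is divisible by
   3. *)
rewrite eqf_sqr pE; case: (odd _) => /= /orP[]/eqP; lia.
Qed.

(** * The affine stabilizer of the base block *)

Lemma base_block_stabilizer (a b : F) : a != 0 ->
  ([set a * x + b | x in B] == B) = (a ^+ 3 == 1) && (b ^+ 4 == b).
Proof.
move=> a0; have trD := abs_traceD cardF; have addFF := addrr_pchar2 (pcharF2 cardF).
have inj_ab : injective (fun x => a * x + b) by move=> x y /addIr /(mulfI a0).
have trE u : tr ((a * u + b) ^+ 3)
    = tr (a ^+ 3 * u ^+ 3) + tr (u ^+ 2 * (a ^+ 2 * (b + b ^+ 4))) + tr (b ^+ 3).
  by rewrite abs_trace_cubeD; congr (tr _ + tr _ + _); ring.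
apply/eqP/andP => [stab|[/eqP a3 b4]]; last first.
  have bb : b + b ^+ 4 = 0 by apply/eqP; rewrite addr_expr4_eq0.
  apply/eqP; rewrite eqEcard card_imset // leqnn andbT.
  apply/subsetP => _ /imsetP[u Bu ->]; move: Bu; rewrite !inE trE a3 bb.
  by rewrite !mulr0 (fixed_expr4_trace (eqP b4)) abs_trace0 !addr0 mul1r.
have {}stab u : tr ((a * u + b) ^+ 3) = tr (u ^+ 3).
  have := mem_imset [in B] u inj_ab; rewrite stab !inE.
  have o0 := oner_eq0 F.
  by case: (abs_trace01 m_gt0 cardF (u ^+ 3)) => ->;
     case: (abs_trace01 m_gt0 cardF ((a * u + b) ^+ 3)) => ->;
     rewrite // eqxx eq_sym o0.
have trb : tr (b ^+ 3) = 0.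
  by have := stab 0; rewrite mulr0 add0r expr0n abs_trace0.
(* The claim amounts to [c = 0] and [d = 0]. The trace of [c * u ^+ 3] equals that of [u ^+ 2 * d],
   hence is additive in [u]; its polarization must vanish, which gives [cu]. *)
pose c := a ^+ 3 + 1; pose d := a ^+ 2 * (b + b ^+ 4).
have trc u : tr (c * u ^+ 3) = tr (u ^+ 2 * d).
  by rewrite mulrDl mul1r trD -(stab u) trE trb addr0 addrA addFF add0r.
have c0 : c = 0.
  have cu u : c * u + c ^+ 2 * u ^+ 4 = 0.
    apply: (abs_trace_nondeg m_gt0 cardF) => v.
    have uv : c * (u + v) ^+ 3
        = c * u ^+ 3 + c * v ^+ 3 + (v * (c * u ^+ 2) + v ^+ 2 * (c * u)).
      rewrite -[RHS]addr0 -(mul0r (c * (u ^+ 2 * v + u * v ^+ 2))).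
      by rewrite -(two_eq0 cardF); ring.
    have : tr (c * (u + v) ^+ 3) = tr (c * u ^+ 3) + tr (c * v ^+ 3).
      rewrite !trc -trD; congr tr.
      rewrite -[RHS]addr0 -(mul0r (u * v * d)).
      by rewrite -(two_eq0 cardF); ring.
    rewrite uv !trD -[RHS]addr0 => /addrI.
    have -> : tr (v * (c * u ^+ 2)) = tr (v ^+ 2 * (c ^+ 2 * u ^+ 4)).
      by rewrite -(abs_trace_sqr m_gt0 cardF); congr tr; ring.
    by rewrite mulrDr trD addrC.
  (* If [c] is nonzero, [u = 1] forces [c = 1]; then [u ^+ 4 = u] for all [u], so the field has 4
     elements, against [4 <= m]. *)
  apply/eqP/negPn/negP => cn0; move: (cu 1).
  rewrite !expr1n !mulr1 expr2 -{1}[c]mulr1 -mulrDr.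
  move/eqP; rewrite mulf_eq0 (negPf cn0) addr_eq0 (oppr_pchar2 (pcharF2 cardF)).
  move=> /eqP c1.
  have : #|F| = 4%N.
    rewrite -card_fixed_expr4; apply: eq_card => u; rewrite !inE.
    rewrite -addr_expr4_eq0; have := cu u.
    by rewrite -c1 expr1n !mul1r => ->; rewrite eqxx.
  by rewrite cardF => /(@expnI 2 isT m 2) m2; have := m_ge4; rewrite m2.
have a3 : a ^+ 3 = 1.
  by apply/eqP; rewrite -(oppr_pchar2 (pcharF2 cardF) 1) -addr_eq0 -/c c0.
split; first exact/eqP.
rewrite -addr_expr4_eq0 -(mulrI_eq0 _ (mulfI (expf_neq0 2 a0))).
apply/eqP/(abs_trace_nondeg m_gt0 cardF) => u.
by rewrite -/d -trc c0 mul0r abs_trace0.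
Qed.

(** * Counting affine maps, encoded by their coefficient pairs, and blocks *)

Local Notation block p := [set p.1 * x + p.2 | x in B].

(** Composition with [a0 * x + b0] on the left carries the stabilizer of [B], of order 3 * 4,
    bijectively onto the maps giving this block. *)
Lemma card_block_fiber (a0 b0 : F) : a0 != 0 ->
  #|[set p : F * F | (p.1 != 0) && (block p == [set a0 * x + b0 | x in B])]|
  = 12%N.
Proof.
move=> a0n0.
pose S := setX [set a : F | a ^+ 3 == 1] [set b : F | b ^+ 4 == b].
have cardS : #|S| = 12%N by rewrite cardsX card_cube_roots1 // card_fixed_expr4.
have inj0 : injective (fun x => a0 * x + b0) by move=> x y /addIr /(mulfI a0n0).
pose comp (s : F * F) := (a0 * s.1, a0 * s.2 + b0).
have inj_comp : injective comp.
  by move=> [a b] [a' b'] [/(mulfI a0n0) -> /addIr/(mulfI a0n0) ->].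
have comp_block s : block (comp s) = [set a0 * x + b0 | x in block s].
  rewrite -imset_comp; apply: eq_imset => x /=.
  by rewrite mulrDr mulrA addrA.
rewrite -cardS -[RHS](card_imset _ inj_comp); apply: eq_card => p.
have [s ->] : exists s, p = comp s.
  exists (p.1 / a0, (p.2 - b0) / a0).
  by case: p => a b; rewrite /comp /= ![a0 * _]mulrC !divfK ?subrK.
rewrite [RHS]mem_imset // [LHS]inE comp_block (inj_eq (imset_inj inj0)) !inE /=.
rewrite mulf_eq0 (negPf a0n0) /=.
have [s0|s0] := eqVneq s.1 0; last exact: base_block_stabilizer.
by rewrite s0 expr0n /= [0 == 1]eq_sym oner_eq0.
Qed.

Lemma GA1_blocksE : GA1_blocks B = [set block p | p in [set p : F * F | p.1 != 0]].
Proof.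
apply/setP => Y; apply/imsetP/imsetP => [[g /imset2P[a b]]|[[a b]]].
  rewrite !inE => a0 _ -> ->; exists (a, b); first by rewrite inE.
  by apply: eq_imset => x; rewrite ffunE.
rewrite inE /= => a0 ->; exists [ffun x => a * x + b].
  by apply/imset2P; exists a b; rewrite ?inE.
by apply: eq_imset => x; rewrite ffunE.
Qed.

(* Both sides count the affine maps [g] with [x, y] in the block [g B]:
   each block is the image under 12 maps, and [g] is determined by the
   ordered pair of distinct preimages of [x] and [y] in [B]. *)
Lemma card_blocks_through (x y : F) : x != y ->
  (#|[set Y in GA1_blocks B | [set x; y] \subset Y]| * 12 = #|B| * #|B|.-1)%N.
Proof.
move=> xy; have yx0 : y - x != 0 by rewrite subr_eq0 eq_sym.
pose D := [set p : F * F | (p.1 != 0) && ([set x; y] \subset block p)].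
have -> : [set Y in GA1_blocks B | [set x; y] \subset Y] = [set block p | p in D].
  apply/setP => Y; rewrite inE GA1_blocksE; apply/andP/imsetP.
    by case=> /imsetP[p /[!inE] p0 ->] xyp; exists p; rewrite // inE p0.
  by case=> p /[!inE] /andP[p0 xyp] ->; split=> //; apply/imsetP; exists p; rewrite ?inE.
rewrite -(card_fibers (f := fun p => block p) (n := 12)); last first.
  move=> p; rewrite inE => /andP[p0 xyp].
  rewrite -[RHS](card_block_fiber p.2 p0); apply: eq_card => p'; rewrite !inE.
  by case: (block p' =P block p) => [->|]; rewrite ?xyp ?andbT ?andbF.
(* The ordered pairs of distinct points of [B]; [pre] will map [D] bijectively onto them. *)
pose E := [set q : F * F | (q.1 \in B) && (q.2 \in B :\ q.1)].
have -> : (#|B| * #|B|.-1)%N = #|E|.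
  transitivity (\sum_(u in B) \sum_(v in B :\ u) 1)%N.
    rewrite -sum_nat_const; apply: eq_bigr => u Bu.
    by rewrite sum1_card (cardsD1 u) Bu.
  by rewrite pair_big_dep /= sum1dep_card.
pose pre (p : F * F) := ((x - p.2) / p.1, (y - p.2) / p.1).
have blockP p z : p.1 != 0 -> (z \in block p) = ((z - p.2) / p.1 \in B).
  move=> p0; apply/imsetP/idP => [[u Bu ->]|Bz]; first by rewrite addrK mulrC mulKf.
  by exists ((z - p.2) / p.1); rewrite // mulrC divfK ?subrK.
have injpre : {in D &, injective pre}.
  move=> [a b] [a' b'] /[!inE] /andP[/= an0 _] /andP[/= a'n0 _] [e1 e2].
  (* The difference of the two preimages determines the slope. *)
  have e3 : (y - x) / a = (y - x) / a'.
    transitivity ((y - b) / a - (x - b) / a); first by ring.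
    by rewrite e1 e2; ring.
  have ea : a = a' by apply: invr_inj; apply: (mulfI yx0).
  subst a'; congr (_, _); apply: oppr_inj; apply: (addrI x).
  by apply: (divIf an0).
rewrite -(card_in_imset injpre); apply: eq_card => [[u v]].
apply/imsetP/idP => [[p]|].
  rewrite in_set subUset !sub1set => /andP[p0]; rewrite !blockP //.
  case/andP=> xB yB [-> ->]; rewrite in_set /= in_setD1 xB yB andbT /=.
  by apply: contra_neq xy => /(divIf p0)/addIr.
rewrite in_set /= in_setD1 => /and3P[uB vu vB].
have vu0 : v - u != 0 by rewrite subr_eq0.
(* The slope of the affine map that sends [u] to [x] and [v] to [y]. *)
have a0 : (y - x) / (v - u) != 0 by rewrite mulf_neq0 ?invr_eq0.
have ux : (x - (x - (y - x) / (v - u) * u)) / ((y - x) / (v - u)) = u.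
  by field; rewrite vu0 yx0.
have vy : (y - (x - (y - x) / (v - u) * u)) / ((y - x) / (v - u)) = v.
  by field; rewrite vu0 yx0.
exists ((y - x) / (v - u), x - (y - x) / (v - u) * u); last by rewrite /pre /= ux vy.
by rewrite in_set subUset !sub1set !blockP // a0 /= ux vy uB vB.
Qed.

End Cube.

Theorem theorem17 (m : nat) (F : finFieldType) :
  (4 <= m)%N -> ~~ odd m -> #|F| = (2 ^ m)%N ->
  exists k lambda : nat,
    [/\ k%:Z = 2 ^+ (m - 1) + (- 2) ^+ (m %/ 2),
        lambda%:R = k%:R * (k%:R - 1) / 12 :> rat
      & is_design [set: F] (GA1_blocks (base_block F m)) 2 (2 ^ m) k lambda].
Proof.
move=> m4 m_even cardF; set B := base_block F m.
pose through (X : {set F}) := [set Y in GA1_blocks B | X \subset Y].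
have count := card_blocks_through m4 m_even cardF.
(* The pair of 0 and 1 is a sample: [count] gives the same number for every pair. *)
exists #|B|, #|through [set 0; 1]|; split.
- exact: card_base_block.
- have := count 0 1; rewrite eq_sym oner_eq0 => /(_ isT).
  move/(congr1 (fun n : nat => n%:R : rat)); rewrite !natrM => eq12.
  apply: (@mulIf _ (12 : rat)) => //; rewrite divfK // eq12.
  (* The truncated predecessor differs from [k - 1] only at zero, where the other factor
     vanishes. *)
  by case: #|B| => [|k]; rewrite ?mul0r //= -natr1 addrK.
split=> [|X|X _ /eqP/cards2P[x [y [xy ->]]]].
- by rewrite cardsT.
- rewrite /GA1_blocks => /imsetP[_ /imset2P[a b /[!inE] a0 _ ->] ->].
  split; first exact: subsetT.
  by apply: card_imset => x y; rewrite !ffunE => /addIr/(mulfI a0).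
have := count 0 1; rewrite eq_sym oner_eq0 => /(_ isT).
rewrite -(count x y xy) => /eqP; rewrite eqn_pmul2r // => /eqP; exact.
Qed.
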